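(* Let $G$ be a connected graph and suppose $G\in\mathcal{D}(p_1,\ldots,p_{\mathrm{diam}_e(G)})$. Then $$W(G)\leq \left(1+\mathrm{diam}_e(G)\right)\Delta(G)-\sum_{i=1}^{\mathrm{diam}_e(G)}p_i.$$
   Context: All graphs are finite, undirected, without loops or multiple edges; $\Delta(G)$ is the maximum degree. An interval $t$-coloring of a graph $G$ ($t$ a positive integer) is a proper edge-coloring of $G$ with colors $1,\ldots,t$ such that all colors are used and, for each vertex $v$, the set of colors of the edges incident to $v$ is an interval of integers. $G$ is interval colorable if it has an interval $t$-coloring for some positive integer $t$; then $W(G)$ denotes the maximum such $t$. For edges $e=u_1u_2$ and $e'=v_1v_2$ of a connected graph $G$, $d(e,e')=\min_{1\le i\le 2,\,1\le j\le 2}d(u_i,v_j)$, and $\mathrm{diam}_e(G)=\max_{e,e'\in E(G)}d(e,e')$. For positive integers $p_1,\ldots,p_{\mathrm{diam}_e(G)}$, we write $G\in\mathcal{D}(p_1,\ldots,p_{\mathrm{diam}_e(G)})$ if $G$ is interval colorable and, for every $k$ with $1\le k\le\mathrm{diam}_e(G)$ and every pair of vertices $u,v\in V(G)$ with $d(u,v)=k$, there are distinct vertices $v_1,\ldots,v_{p_k}$ such that $d(u,v_i)=k-1$ and $v_iv\in E(G)$ for $i=1,\ldots,p_k$. *)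

(* Defs.v *)
From mathcomp Require Import all_boot all_order all_algebra.

Set Implicit Arguments.
Unset Strict Implicit.
Unset Printing Implicit Defensive.

Record sgraph := SGraph {
  svertex :> finType;
  adj : rel svertex;
  adj_sym : symmetric adj;
  adj_irr : irreflexive adj }.

Section Graph.
Variable G : sgraph.
Implicit Types (u v w : G) (f g h : {set G}).

Definition connected : Prop := forall u v, connect (@adj G) u v.

(* An edge is the two-element set of its endpoints. *)
Definition edges : {set {set G}} :=
  [set [set p.1; p.2] | p : G * G & adj p.1 p.2].

Definition incident v : {set {set G}} := [set f in edges | v \in f].

Definition deg v : nat := #|[set w | adj v w]|.

Definition maxdeg : nat := \max_v deg v.

Definition walk_of_length (k : nat) u v : bool :=
  [exists p : k.-tuple G, path (@adj G) u p && (last u p == v)].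

(* Shortest paths have length less than #|G|; the default value #|G| is only
   attained when u and v lie in different components. *)
Definition dist u v : nat :=
  \big[minn/#|G|]_(k < #|G| | walk_of_length k u v) k.

Definition edge_dist f g : nat :=
  \big[minn/#|G|]_(u in f) \big[minn/#|G|]_(v in g) dist u v.

Definition diam_e : nat := \max_(f in edges) \max_(g in edges) edge_dist f g.

(* Only the values of c on edges matter. *)
Definition interval_coloring (t : nat) (c : {set G} -> nat) : bool :=
  [&& [forall f in edges, 1 <= c f <= t],
      [forall k : 'I_t, exists f in edges, c f == k.+1],
      [forall f in edges, forall g in edges,
         (f != g) && (f :&: g != set0) ==> (c f != c g)]
    & [forall v, forall f in incident v, forall g in incident v,
         forall k : 'I_t.+1,
         (c f <= k <= c g) ==> [exists h in incident v, c h == k]]].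

(* Restricting to finite functions makes the predicate decidable; this is
   harmless by has_interval_coloringP. *)
Definition has_interval_coloring (t : nat) : bool :=
  [exists c : {ffun {set G} -> 'I_t.+1}, interval_coloring t (fun f => c f)].

Definition interval_colorable : Prop :=
  exists2 t, 0 < t & has_interval_coloring t.

(* All t colors occur on edges, so t <= #|edges|; see W_max. *)
Definition W : nat :=
  \max_(t < #|edges|.+1 | (0 < t) && has_interval_coloring t) t.

(* p k stands for p_k; only the indices 1 <= k <= diam_e are relevant. *)
Definition in_D (p : nat -> nat) : Prop :=
  [/\ interval_colorable,
      forall k, 1 <= k <= diam_e -> 0 < p k
    & forall k, 1 <= k <= diam_e -> forall u v, dist u v = k ->
        exists s : (p k).-tuple G,
          uniq s /\ {in s, forall w, dist u w = k - 1 /\ adj w v}].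

Lemma interval_coloring_eq t (c c' : {set G} -> nat) :
  {in edges, c =1 c'} -> interval_coloring t c -> interval_coloring t c'.
Proof.
move=> cc' /and4P[/forall_inP h1 /forallP h2 /forall_inP h3 /forallP h4].
have inc v f : f \in incident v -> c f = c' f.
  by rewrite inE => /andP[fE _]; apply: cc'.
apply/and4P; split.
- by apply/forall_inP => f fE; rewrite -cc' // h1.
- apply/forallP => k; have /exists_inP[f fE cf] := h2 k.
  by apply/exists_inP; exists f; rewrite // -cc'.
- apply/forall_inP => f fE; apply/forall_inP => g gE.
  by rewrite -!cc' //; have /forall_inP/(_ g gE) := h3 f fE.
- apply/forallP => v; apply/forall_inP => f fv; apply/forall_inP => g gv.
  apply/forallP => k; apply/implyP; rewrite -(inc v f) // -(inc v g) // => fkg.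
  have /forall_inP/(_ f fv)/forall_inP/(_ g gv)/forallP/(_ k) := h4 v.
  move=> /implyP/(_ fkg)/exists_inP[h hv ch].
  by apply/exists_inP; exists h; rewrite // -(inc v h).
Qed.

Lemma has_interval_coloringP t :
  reflect (exists c : {set G} -> nat, interval_coloring t c)
          (has_interval_coloring t).
Proof.
apply: (iffP existsP) => [[c hc]|[c hc]]; first by exists (fun f => nat_of_ord (c f)).
exists [ffun f => inord (c f)]; apply: (interval_coloring_eq _ hc) => f fE.
rewrite ffunE inordK //.
have /and4P[/forall_inP/(_ f fE)/andP[_ cf] _ _ _] := hc.
exact: cf.
Qed.

Lemma interval_coloring_card t (c : {set G} -> nat) :
  interval_coloring t c -> t <= #|edges|.
Proof.
case/and4P => _ /forallP h _ _.
have hx (k : 'I_t) : {f | f \in edges & c f = k.+1}.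
  have [f /andP[fE /eqP cf]] := sigW (existsP (h k)); by exists f.
pose F k := s2val (hx k).
have Fi : injective F.
  move=> i j eF; apply: val_inj; apply: succn_inj.
  by rewrite -(s2valP' (hx i)) -(s2valP' (hx j)); congr c.
rewrite -[X in X <= _](card_ord t) -(card_imset _ Fi).
by apply/subset_leq_card/subsetP => _ /imsetP[k _ ->]; apply: s2valP (hx k).
Qed.

Lemma W_max : interval_colorable ->
  [/\ 0 < W, has_interval_coloring W
    & forall t, 0 < t -> has_interval_coloring t -> t <= W].
Proof.
have le_W t : 0 < t -> has_interval_coloring t -> t <= W.
  move=> t0 ht; have [c hc] := elimT (has_interval_coloringP t) ht.
  have lt : t < #|edges|.+1 by rewrite ltnS (interval_coloring_card hc).
  by apply: (bigmax_sup (Ordinal lt)) => //=; rewrite t0.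
case=> t t0 ht.
have W0 : 0 < W by apply: leq_trans t0 (le_W t t0 ht).
split=> //; move: W0; rewrite /W.
apply: (@big_ind _ (fun x => 0 < x -> has_interval_coloring x)) => //.
- by move=> x y hx hy; rewrite /maxn; case: ifP.
- by move=> i /andP[].
Qed.

Lemma dist_le_walk k u v : walk_of_length k u v -> dist u v <= k.
Proof.
move=> hk; case: (ltnP k #|G|) => [lt|ge].
  rewrite /dist; have := mem_index_enum (Ordinal lt).
  elim: (index_enum _) => // i r IH; rewrite inE big_cons => /predU1P[<-|ir].
    by rewrite hk geq_minl.
  by case: ifP => _; rewrite ?geq_min IH ?orbT.
apply: leq_trans ge; rewrite /dist.
by apply: (@big_ind _ (fun x => x <= #|G|)) => // [x y hx _|i _];
  [rewrite geq_min hx | apply: ltnW].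
Qed.

Lemma dist_walk u v : connect (@adj G) u v -> walk_of_length (dist u v) u v.
Proof.
case/connectP => p0 /shortenP[p pp up _] ->.
have hp : walk_of_length (size p) u (last u p).
  by apply/existsP; exists (in_tuple p); rewrite pp /=.
have lt : size p < #|G| by rewrite -[(size p).+1]/(size (u :: p)) -(card_uniqP up) max_card.
have : dist u (last u p) < #|G| by apply: leq_ltn_trans (dist_le_walk hp) lt.
rewrite /dist; set v' := last u p.
apply: (@big_ind _ (fun x => x < #|G| -> walk_of_length x u v')) => //.
- by rewrite ltnn.
- by move=> x y hx hy; rewrite /minn; case: ifP.
Qed.

End Graph.

(* Main.v *)
Require Import Defs.
From mathcomp Require Import all_boot all_order all_algebra.
From mathcomp Require Import zify.

(** Take an interval coloring with t = W(G) colors, an edge f of color 1, an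
    edge g of color t, and endpoints u of f and v of g realizing the distance
    d of the two edges.  Walk back from v to u one distance level at a time.
    At a vertex of level k > 0, fix p_k incident edges leading to level k - 1
    ([back_edges]); the walk leaves by the one of largest color.  The
    colors at a vertex fill an interval of length at most Delta, and p_k - 1 of them lie below the color of the edge chosen, so this step
    loses at most Delta - p_k in color ([color_drop]).  At u, where f is the
    only edge aimed at, the loss is at most Delta - 1.  Summing up
    ([color_le_dist]) gives the bound with d in place of diam_e(G).

    Since d <= diam_e(G), it remains to see that enlarging d does not decrease
    the bound, that is, p_k <= Delta for all k up to diam_e(G)
    ([p_le_maxdeg]).  This holds because every such k is a distance between
    two vertices: diam_e(G) itself is one, and the property defining
    D(p_1, ...) allows one to descend from a distance to the previous one. *)

(** The default [m] is harmless because it bounds all the values on [A]; it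
    would otherwise be able to undercut them. *)
Lemma bigmin_attained (T : finType) (A : {set T}) (F : T -> nat) (m : nat) :
  A != set0 -> {in A, forall x, F x <= m} ->
  exists2 x, x \in A & \big[minn/m]_(y in A) F y = F x.
Proof.
case/set0Pn=> x0 Ax0 Fm.
have [x Ax' xmin] := arg_minnP F Ax0; have Ax : x \in A := Ax'.
have mono (s : seq T) : x \in s -> \big[minn/m]_(y <- s | y \in A) F y <= F x.
  elim: s => // y s IHs; rewrite inE big_cons => /predU1P[<-|/IHs IH].
    by rewrite Ax geq_minl.
  by case: ifP => // _; rewrite geq_min IH orbT.
exists x => //; apply/eqP; rewrite eqn_leq mono ?mem_index_enum //=.
apply: (@big_ind _ (fun n => F x <= n)) => [|a b xa xb|y Ay].
- exact: Fm.
- by rewrite leq_min xa.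
- exact: xmin.
Qed.

Section IntervalColoring.

Set Implicit Arguments.
Unset Strict Implicit.

Variable G : sgraph.
Implicit Types (u v w : G) (f g h : {set G}).

Lemma adj_incident w v : adj w v ->
  [set w; v] \in incident w /\ [set w; v] \in incident v.
Proof.
move=> wv; have E : [set w; v] \in edges G.
  by apply/imsetP; exists (w, v); rewrite ?inE.
by split; apply/setIdP; rewrite ?set21 ?set22.
Qed.

Lemma card_incident v : #|incident v| <= maxdeg G.
Proof.
apply: leq_trans (leq_bigmax v); rewrite /deg.
have inc_nbr : incident v \subset
    [set [set w; v] | w in [set w | adj v w]].
  apply/subsetP=> f; rewrite inE => /andP[/imsetP[[a b] /= ab ->]].
  rewrite !inE /= in ab *; case/orP=> /eqP ->; apply/imsetP.
    by exists b; rewrite ?inE // setUC.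
  by exists a; rewrite ?inE // adj_sym.
exact: leq_trans (subset_leq_card inc_nbr) (leq_imset_card _ _).
Qed.

(** The largest color on [S] is reached at [h]; the interval condition puts an
    edge at [v] on each color above it up to that of [g], and these edges are
    outside [S]. *)
Lemma color_drop t (c : {set G} -> nat) v g (S : {set {set G}}) :
  interval_coloring t c -> g \in incident v ->
  S \subset incident v -> S != set0 ->
  exists2 h, h \in S & c g + #|S| <= c h + maxdeg G.
Proof.
case/and4P=> /forall_inP ct _ _ /forallP cI gv Sv /set0Pn[h0 Sh0].
have [h Sh' hmax] := arg_maxnP c Sh0; have Sh : h \in S := Sh'.
exists h => //.
pose T := [set x in incident v | c h < c x <= c g].
have hv : h \in incident v := subsetP Sv h Sh.
have cgt : c g <= t.
  by move: gv; rewrite inE => /andP[/ct/andP[]].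
have cardT : c g - c h <= #|T|.
  rewrite -(size_iota (c h).+1 (c g - c h)) cardE -(size_map c).
  apply: (uniq_leq_size (iota_uniq _ _)) => k; rewrite mem_iota => kI.
  have kt : k < t.+1 by lia.
  have /forall_inP/(_ h hv)/forall_inP/(_ g gv)/forallP/(_ (Ordinal kt)) := cI v.
  have -> /= : c h <= Ordinal kt <= c g by move=> /=; lia.
  case/exists_inP=> x xv /eqP cx; apply/mapP; exists x => //.
  by rewrite mem_enum inE xv /=; lia.
have disST : [disjoint S & T].
  rewrite -setI_eq0; apply/eqP/setP=> x; rewrite !inE.
  by apply/negP=> /and3P[/hmax /= xh _]; lia.
have cardST : #|S| + #|T| <= maxdeg G.
  have [_] := leq_card_setU S T; rewrite disST => /eqP <-.
  apply: leq_trans (card_incident v).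
  apply: subset_leq_card; rewrite subUset Sv.
  by apply/subsetP=> x; rewrite inE => /andP[].
lia.
Qed.

Lemma edge_dist_attained f g : f \in edges G -> g \in edges G ->
  exists u v, [/\ u \in f, v \in g & dist u v = edge_dist f g].
Proof.
move=> fE gE.
have edge0 h : h \in edges G -> h != set0.
  case/imsetP=> -[a b] _ -> /=; apply/set0Pn; exists a; exact: set21.
have dist_card u v : dist u v <= #|G|.
  rewrite /dist; apply: (@big_ind _ (fun n => n <= #|G|)) => // [a b|i _].
    by rewrite geq_min => ->.
  exact: ltnW.
have inner u : exists2 v, v \in g & \big[minn/#|G|]_(v in g) dist u v = dist u v.
  by apply: bigmin_attained; rewrite ?edge0.
have [|u _|u uf eu] := bigmin_attained _ f
    (fun u => \big[minn/#|G|]_(v in g) dist u v) #|G|.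
- exact: edge0.
- by have [v _ ->] := inner u.
- by have [v vg ev] := inner u; exists u, v; rewrite /edge_dist eu ev.
Qed.

Lemma dist_eq0 u v : connected G -> dist u v = 0 -> u = v.
Proof.
move=> Gc d0; have := dist_walk (Gc u v); rewrite d0.
by case/existsP=> s; rewrite (tuple0 s) => /andP[_ /eqP].
Qed.

Variable p : nat -> nat.
Hypotheses (Gc : connected G) (GD : in_D G p).

Lemma back_edges k u v : 0 < k <= diam_e G -> dist u v = k ->
  exists S : {set {set G}}, [/\ S \subset incident v, #|S| = p k &
    {in S, forall h, exists2 w, dist u w = k.-1 & h \in incident w}].
Proof.
case: GD => _ _ pD kI duv; have [s [s_uniq sP]] := pD k kI u v duv.
exists [set [set w; v] | w in s]; split.
- apply/subsetP=> _ /imsetP[w /sP[_ wv] ->]; exact: (adj_incident wv).2.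
- rewrite card_in_imset ?(card_uniqP s_uniq) ?size_tuple // => w w' /sP[_ wv] _ eww'.
  have : w \in [set w'; v] by rewrite -eww' set21.
  by rewrite !inE => /orP[/eqP //|/eqP ewv]; rewrite ewv adj_irr in wv.
- move=> _ /imsetP[w /sP[dw wv] ->]; exists w; first by rewrite dw subn1.
  exact: (adj_incident wv).1.
Qed.

(** Induction on the level [k] of [v], with [color_drop] applied to the edges
    from [v] to level [k - 1], or to [f] alone when [k = 0]; this last drop
    is at most [maxdeg G - 1], hence the summand 1. *)
Lemma color_le_dist t (c : {set G} -> nat) f u k v g :
  interval_coloring t c -> f \in incident u -> g \in incident v ->
  dist u v = k -> k <= diam_e G ->
  c g + 1 + \sum_(1 <= i < k.+1) p i <= c f + k.+1 * maxdeg G.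
Proof.
move=> cI fu; elim: k v g => [|k IHk] v g gv duv kD.
  have euv := dist_eq0 Gc duv; rewrite -euv in gv.
  have [|| h] := color_drop cI gv (S := [set f]); rewrite ?sub1set //.
    by apply/set0Pn; exists f; rewrite inE.
  by rewrite inE => /eqP ->; rewrite cards1 big_geq //; lia.
have [S [Sv cardS SP]] := back_edges (k := k.+1) kD duv.
have S0 : S != set0.
  by case: GD => _ p0 _; rewrite -card_gt0 cardS p0.
have [h Sh hP] := color_drop cI gv Sv S0.
have [w dw hw] := SP h Sh.
have := IHk w h hw dw (ltnW kD); rewrite [in X in _ -> X]big_nat_recr //=.
by rewrite cardS in hP; lia.
Qed.

(** Descent from the two endpoints realizing [diam_e G]: an edge from level
    [k] back to level [k - 1] exists because [p k] is positive. *)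
Lemma dist_attained k : edges G != set0 -> k <= diam_e G ->
  exists u v, dist u v = k.
Proof.
case/set0Pn=> e eE /subKn <-; elim: (diam_e G - k) => [|j [u [v duv]]].
  rewrite subn0.
  have E0 : 0 < #|edges G| by rewrite card_gt0; apply/set0Pn; exists e.
  have [f fE Df] := eq_bigmax_cond
    (fun f => \max_(g in edges G) edge_dist f g) E0.
  have [g gE Dg] := eq_bigmax_cond (edge_dist f) E0.
  have [u [v [_ _ duv]]] := edge_dist_attained fE gE.
  by exists u, v; rewrite duv -Dg -Df.
(* Once distance 0 is reached, the truncated subtraction stays there. *)
have [Dj|jD] := leqP (diam_e G) j.
  by exists u, v; rewrite duv; lia.
have kI : 0 < diam_e G - j <= diam_e G by lia.
case: GD => _ p0 _; have [S [_ cardS SP]] := back_edges kI duv.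
have /card_gt0P[h /SP[w dw _]] : 0 < #|S| by rewrite cardS p0.
by exists u, w; rewrite dw; lia.
Qed.

Lemma p_le_maxdeg k : edges G != set0 -> 0 < k <= diam_e G -> p k <= maxdeg G.
Proof.
move=> E0 kI; have /andP[_ kD] := kI.
have [u [v duv]] := dist_attained E0 kD.
have [S [Sv <- _]] := back_edges kI duv.
exact: leq_trans (subset_leq_card Sv) (card_incident v).
Qed.

Lemma W_bound :
  W G + \sum_(1 <= i < (diam_e G).+1) p i <= (diam_e G).+1 * maxdeg G.
Proof.
have Gcol : interval_colorable G by case: GD.
have [W0 /has_interval_coloringP[c cI] _] := W_max Gcol.
have /and4P[_ /forallP cE _ _] := cI.
have color k : 0 < k <= W G -> exists2 f, f \in edges G & c f = k.
  move=> kI; have kW : k.-1 < W G by lia.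
  have /exists_inP[f fE /eqP cf] := cE (Ordinal kW).
  by exists f => //; rewrite cf prednK; lia.
have [f fE cf] := color 1%N W0.
have [|g gE cg] := color (W G); first by rewrite W0 /=.
have [u [v [uf vg duv]]] := edge_dist_attained fE gE.
have dD : dist u v <= diam_e G.
  rewrite duv; apply: leq_trans (leq_bigmax_cond _ fE).
  exact: leq_bigmax_cond.
have fu : f \in incident u by rewrite inE fE.
have gv : g \in incident v by rewrite inE gE.
have := color_le_dist cI fu gv erefl dD; rewrite cf cg.
have E0 : edges G != set0 by apply/set0Pn; exists f.
rewrite (big_cat_nat (n := (dist u v).+1) (p := (diam_e G).+1)) //=.
have : \sum_((dist u v).+1 <= i < (diam_e G).+1) p i
       <= (diam_e G - dist u v) * maxdeg G.
  rewrite -subSS -sum_nat_const_nat !big_nat.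
  by apply: leq_sum => i iI; apply: p_le_maxdeg => //; lia.
have <- : (dist u v).+1 * maxdeg G + (diam_e G - dist u v) * maxdeg G
          = (diam_e G).+1 * maxdeg G by rewrite -mulnDl; congr muln; lia.
lia.
Qed.

End IntervalColoring.

Theorem theorem5p1 (G : sgraph) (p : nat -> nat) :
  connected G -> in_D G p ->
  ((W G)%:Z <= (1 + (diam_e G)%:Z) * (maxdeg G)%:Z
               - \sum_(1 <= i < (diam_e G).+1) (p i)%:Z)%R.
Proof.
move=> Gc GD; have := W_bound Gc GD.
rewrite -(big_morph Posz PoszD (erefl _)); lia.
Qed.
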